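(* For every integer $a\geq 1$, each of the sets $B_a=\{x\in\mathbb{N}_0: t(x+a)=1-t(x)\}$ and $C_a=\{x\in\mathbb{N}_0: t(x+a)=t(x)\}$ can be obtained from the two sets $B_1$ and $C_1$ by a finite number of applications of the operations of translation $E_h$ ($h\in\mathbb{Z}$), union and intersection.
   Context: $\mathbb{N}_0=\{0,1,2,\dots\}$. $t(n)$ is the Thue–Morse sequence: $t(n)=0$ if the binary expansion of $n$ has an even number of $1$'s, $t(n)=1$ otherwise. For $a\ge1$, $B_a$ and $C_a$ are the solution sets in $\mathbb{N}_0$ of $t(x+a)=1-t(x)$ and $t(x+a)=t(x)$ respectively; in particular $B_1=\{x: t(x+1)=1-t(x)\}$, $C_1=\{x:t(x+1)=t(x)\}$. For a set of integers $A$ and $h\in\mathbb{Z}$, the translation operator is $E_h(A)=\{y-h: y\in A\}$. *)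

(* Defs.v *)
From mathcomp Require Import all_boot all_order all_algebra.
From mathcomp Require Import classical_sets.

Set Implicit Arguments.
Unset Strict Implicit.
Unset Printing Implicit Defensive.

Import GRing.Theory.
Local Open Scope classical_set_scope.
Local Open Scope ring_scope.

(* The binary digits of n in positions i >= n all vanish, since n < 2 ^ n. *)
Definition binary_ones (n : nat) : nat := (\sum_(i < n) (n %/ 2 ^ i) %% 2)%N.

(* Integer-valued, so that [1 - t n] below is not a truncated subtraction. *)
Definition t (n : nat) : int := if odd (binary_ones n) then 1 else 0.

(* The solution sets range over natural numbers but are regarded as sets of
   integers, so that translations by arbitrary integers act on them. *)
Definition B (a : nat) : set int :=
  [set n%:Z | n in [set n : nat | t (n + a)%N = 1 - t n]].

Definition C (a : nat) : set int :=
  [set n%:Z | n in [set n : nat | t (n + a)%N = t n]].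

Definition E (h : int) (A : set int) : set int := [set y - h | y in A].

Inductive obtainable (G : set (set int)) : set int -> Prop :=
| obtainable_base A : G A -> obtainable G A
| obtainable_translation h A : obtainable G A -> obtainable G (E h A)
| obtainable_union A A' :
    obtainable G A -> obtainable G A' -> obtainable G (A `|` A')
| obtainable_intersection A A' :
    obtainable G A -> obtainable G A' -> obtainable G (A `&` A').

(* Main.v *)
(** Comparing [t (x + a + 1)] with [t x] through [t (x + a)] gives
    [B_(a+1) = (B_a /\ E_a C_1) \/ (C_a /\ E_a B_1)] and
    [C_(a+1) = (B_a /\ E_a B_1) \/ (C_a /\ E_a C_1)], whence induction on [a]. *)
Require Import Defs.
From mathcomp Require Import all_boot all_order all_algebra.
From mathcomp Require Import classical_sets.
Local Open Scope classical_set_scope.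

Import GRing.Theory.

Lemma mem_E (h : int) (A : set int) (z : int) : E h A z <-> A (z + h)%R.
Proof.
split=> [[y Ay <-]|Azh]; first by rewrite subrK.
by exists (z + h)%R => //; rewrite addrK.
Qed.

Lemma mem_B (a n : nat) : B a (Posz n) <-> t (n + a) = (1 - t n)%R.
Proof. by split=> [[m tm [<-]]|tn] //; exists n. Qed.

Lemma mem_C (a n : nat) : C a (Posz n) <-> t (n + a) = t n.
Proof. by split=> [[m tm [<-]]|tn] //; exists n. Qed.

Lemma B_sub_nat (a : nat) : B a `<=` range Posz.
Proof. by move=> _ [n _ <-]; exists n. Qed.

Lemma C_sub_nat (a : nat) : C a `<=` range Posz.
Proof. by move=> _ [n _ <-]; exists n. Qed.

(** Translates such as [E (Posz a) (B 1)] can contain negative integers; this confines the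
    comparison to naturals. *)
Lemma eq_set_nat (A A' : set int) :
  A `<=` range Posz -> A' `<=` range Posz ->
  (forall n : nat, A (Posz n) <-> A' (Posz n)) -> A = A'.
Proof.
move=> natA natA' eqAA'; apply/seteqP; split=> z Az.
  by have [n _ nz] := natA _ Az; move: Az; rewrite -nz => /eqAA'.
by have [n _ nz] := natA' _ Az; move: Az; rewrite -nz => /eqAA'.
Qed.

(** As [t] has two values, it changes from [n] to [n + a.+1] iff it changes on exactly one of the
    steps [n] to [n + a] and [n + a] to [n + a.+1]. *)
Lemma B_succ (a : nat) :
  B a.+1 = (B a `&` E (Posz a) (C 1)) `|` (C a `&` E (Posz a) (B 1)).
Proof.
(* The factors [B a] and [C a] discard the negative elements of the translates. *)
apply: eq_set_nat => [|z [[/B_sub_nat]|[/C_sub_nat]] //|n].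
  exact: B_sub_nat.
rewrite /setU /setI /mkset /= !mem_E -!PoszD !mem_B !mem_C addn1 addnS /t.
by do 3!case: odd; intuition.
Qed.

(** Two changes of [t] cancel. *)
Lemma C_succ (a : nat) :
  C a.+1 = (B a `&` E (Posz a) (B 1)) `|` (C a `&` E (Posz a) (C 1)).
Proof.
apply: eq_set_nat => [|z [[/B_sub_nat]|[/C_sub_nat]] //|n].
  exact: C_sub_nat.
rewrite /setU /setI /mkset /= !mem_E -!PoszD !mem_B !mem_C addn1 addnS /t.
by do 3!case: odd; intuition.
Qed.

Theorem theorem1 (a : nat) (ha : (1 <= a)%N) :
  obtainable [set B 1; C 1] (B a) /\ obtainable [set B 1; C 1] (C a).
Proof.
have obtB1 : obtainable [set B 1; C 1] (B 1) by apply: obtainable_base; left.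
have obtC1 : obtainable [set B 1; C 1] (C 1) by apply: obtainable_base; right.
(* Both claims are carried together, since each recurrence involves [B a] and [C a]. *)
case: a ha => // a _; elim: a => [|a [obtB obtC]]; first by split.
rewrite (B_succ a.+1) (C_succ a.+1).
by split; apply: obtainable_union; apply: obtainable_intersection => //;
  apply: obtainable_translation.
Qed.
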